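(* Let $1\le p<\infty$, let $X$ be a Banach space with the $p$-$(SR)$ property and let $Y$ be a reflexive Banach space. If $L(X,Y^{*})=K(X,Y^{*})$, i.e. every bounded linear operator from $X$ to $Y^{*}$ is compact, then the projective tensor product $X\widehat{\bigotimes}_{\pi}Y$ has the $p$-$(SR)$ property.
   Context: A sequence $(x_n)_n$ in a Banach space $Z$ is weakly $p$-summable if $(z^{*}(x_n))_n\in\ell_p$ for every $z^{*}\in Z^{*}$. A bounded subset $K\subseteq Z$ is a Dunford-Pettis set if every weakly null sequence in $Z^{*}$ converges to zero uniformly on $K$. A sequence in $Z$ is $p$-Right null if it is weakly $p$-summable and its set of terms is a Dunford-Pettis set. A bounded subset $K\subseteq Z^{*}$ is a $p$-Right set if $\lim_n\sup_{z^{*}\in K}|z^{*}(z_n)|=0$ for every $p$-Right null sequence $(z_n)_n$ in $Z$. $Z$ has the $p$-sequentially Right property ($p$-$(SR)$) if every $p$-Right set in $Z^{*}$ is relatively weakly compact. *)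

(* Defs.v *)
From HB Require Import structures.
From mathcomp Require Import all_boot all_order all_algebra.
From mathcomp Require Import sesquilinear.
From mathcomp Require Import all_classical all_reals all_analysis.

Set Implicit Arguments.
Unset Strict Implicit.
Unset Printing Implicit Defensive.

Import Order.TTheory GRing.Theory Num.Theory.
Import numFieldNormedType.Exports.

Local Open Scope classical_set_scope.
Local Open Scope ring_scope.

Section BoundedOperators.
Context {R : realType} (X Y : normedModType R).

Definition bop_pred : {pred X -> Y} :=
  mem [set f : X -> Y | linear f /\ continuous f].

(* L(X, Y); by [linear_bounded_continuous] continuity is boundedness *)
Record bop : Type := Bop {
  bop_fun :> X -> Y;
  _ : bop_fun \in bop_pred
}.

HB.instance Definition _ := [isSub for bop_fun].
HB.instance Definition _ := [Choice of bop by <:].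

Lemma bop_linear (f : bop) : linear f.
Proof. by case: f => f /= /set_mem[]. Qed.

Lemma bop_continuous (f : bop) : continuous f.
Proof. by case: f => f /= /set_mem[]. Qed.

HB.instance Definition _ (f : bop) :=
  GRing.isLinear.Build R X Y *:%R f (bop_linear f).

Lemma bop_submod_closed : submod_closed bop_pred.
Proof.
split.
  apply/mem_set; split; first by move=> a u v; rewrite /= scaler0 addr0.
  exact: cst_continuous.
move=> a f g /set_mem[lf cf] /set_mem[lg cg]; apply/mem_set; split.
  move=> b u v /=.
  have -> w : (a *: f + g) w = a *: f w + g w by [].
  rewrite -[RHS]/(b *: (a *: f u + g u) + (a *: f v + g v)) lf lg.
  by rewrite !scalerDr !scalerA [b * a]mulrC -!addrA; congr (_ + _);
     rewrite addrCA.
move=> x; apply: cvgD; last exact: cg.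
by apply: cvgZl_tmp; exact: cf.
Qed.

HB.instance Definition _ :=
  GRing.isSubmodClosed.Build R (X -> Y) bop_pred bop_submod_closed.
HB.instance Definition _ := [SubChoice_isSubLmodule of bop by <:].

Definition op_norm (f : bop) : R := sup [set `|f x| | x in [set x | `|x| <= 1]].


Lemma bop_bounded (f : bop) : exists2 M, 0 <= M & forall x, `|f x| <= M * `|x|.
Proof.
have /linear_bounded_continuous/linear_boundedP fb := @bop_continuous f.
near +oo_R => r; exists r; first by near: r; exact: nbhs_pinfty_ge.
by near: r.
Unshelve. all: by end_near. Qed.

Lemma op_norm_has_sup (f : bop) :
  has_sup [set `|f x| | x in [set x | `|x| <= 1]].
Proof.
split; first by exists `|f 0|, 0; rewrite //= normr0.
have [M M0 fM] := bop_bounded f; exists M => _ [x /= x1 <-].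
by rewrite (le_trans (fM x))// ler_piMr.
Qed.

Lemma op_norm_ge0 (f : bop) : 0 <= op_norm f.
Proof.
apply: le_trans (normr_ge0 (f 0)) _; apply: sup_upper_bound.
  exact: op_norm_has_sup.
by exists 0; rewrite //= normr0.
Qed.

Lemma op_normP (f : bop) x : `|f x| <= op_norm f * `|x|.
Proof.
have [->|x0] := eqVneq x 0; first by rewrite linear0 !normr0 mulr0.
have nx0 : 0 < `|x| by rewrite normr_gt0.
rewrite -ler_pdivrMr//.
have -> : `|f x| / `|x| = `|f (`|x|^-1 *: x)|.
  by rewrite linearZ/= normrZ normfV normr_id mulrC.
apply: sup_upper_bound; first exact: op_norm_has_sup.
by exists (`|x|^-1 *: x); rewrite //= normfZV.
Qed.

Lemma op_norm_le (f : bop) M :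
  (forall x, `|x| <= 1 -> `|f x| <= M) -> op_norm f <= M.
Proof.
move=> fM; apply: ge_sup; first by case: (op_norm_has_sup f).
by move=> _ [x /= x1 <-]; exact: fM.
Qed.

Lemma op_norm_ball (f : bop) x : `|x| <= 1 -> `|f x| <= op_norm f.
Proof.
by move=> x1; rewrite (le_trans (op_normP f x))// ler_piMr// op_norm_ge0.
Qed.

Lemma op_normD (f g : bop) : op_norm (f + g) <= op_norm f + op_norm g.
Proof.
apply: op_norm_le => x x1; rewrite (le_trans (ler_normD _ _))//.
by rewrite lerD// op_norm_ball.
Qed.

Lemma op_normZ (l : R) (f : bop) : op_norm (l *: f) = `|l| * op_norm f.
Proof.
have le a g : op_norm (a *: g) <= `|a| * op_norm g.
  apply: op_norm_le => x x1; rewrite -[(a *: g) x]/(a *: g x) normrZ.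
  by rewrite ler_wpM2l// op_norm_ball.
apply/eqP; rewrite eq_le le/=.
have [->|l0] := eqVneq l 0; first by rewrite normr0 mul0r op_norm_ge0.
rewrite -ler_pdivlMl ?normr_gt0// -normfV.
by rewrite -[in leLHS](scalerK l0 f) le.
Qed.

Lemma op_norm_eq0 (f : bop) : op_norm f = 0 -> f = 0.
Proof.
move=> f0; apply/val_inj/funext => x /=; apply/eqP.
by rewrite -normr_le0 (le_trans (op_normP f x))// f0 mul0r.
Qed.

HB.instance Definition _ :=
  Lmodule_isNormed.Build R bop op_normD op_normZ op_norm_eq0.

End BoundedOperators.

Section BoundedOperatorsComplete.
Context {R : realType} (X : normedModType R) (Y : completeNormedModType R).

Lemma bop_complete (F : set_system (bop X Y)) :
  ProperFilter F -> cauchy F -> cvg F.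
Proof.
move=> FF /cauchy_ballP Fc.
have Fcx e : 0 < e -> exists2 A, F A &
    forall f g x, A f -> A g -> `|f x - g x| <= e * `|x|.
  move=> e0; have [[A B] [/= FA FB] AB] := Fc _ e0.
  exists (A `&` B); first exact: filterI.
  move=> f g x [Af _] [_ Bg]; have := AB (f, g) (conj Af Bg).
  rewrite /= -ball_normE /= => fg.
  rewrite (le_trans (op_normP (f - g) x))// ler_wpM2r//; exact: ltW.
have Fx x : cvg ((fun f : bop X Y => f x) @ F).
  apply: cauchy_cvg; apply/cauchy_ballP => e e0.
  have e'0 : 0 < e / (`|x| + 1) by rewrite divr_gt0// ltr_wpDl.
  have [A FA Ae] := Fcx _ e'0.
  have FAx : F [set f : bop X Y | [set g x | g in A] (f x)].
    by apply: filterS FA => f Af; exists f.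
  exists ([set g x | g in A], [set g x | g in A]); first by split.
  move=> [_ _] /= [[f Af <-] [g Ag <-]]; rewrite -ball_normE /=.
  rewrite (le_lt_trans (Ae _ _ _ Af Ag))// mulrAC ltr_pdivrMr ?ltr_wpDl//.
  by rewrite ltr_pM2l// ltrDl.
pose h x := lim ((fun f : bop X Y => f x) @ F).
have hE x : (fun f : bop X Y => f x) @ F --> h x by exact: Fx.
have hl : linear h.
  move=> a u v; apply: cvg_lim; first exact: norm_hausdorff.
  have -> : (fun f : bop X Y => f (a *: u + v)) =
            (fun f : bop X Y => a *: f u + f v).
    by apply/funext => f; rewrite linearP.
  by apply: cvgD; [apply: cvgZl_tmp|]; exact: hE.
have hA e : 0 < e -> exists2 A, F A &
    forall f x, A f -> `|f x - h x| <= e * `|x|.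
  move=> e0; have [A FA Ae] := Fcx _ e0; exists A => // f x Af.
  apply: (@closed_cvg _ _ F _ (fun g : bop X Y => `|f x - g x|)
    [set r | r <= e * `|x|]).
  - exact: closed_le.
  - by apply: filterS FA => g Ag; exact: Ae.
  - by apply: cvg_norm; apply: cvgB; [exact: cvg_cst|exact: hE].
have hc : continuous h.
  have [A FA A1] := hA 1 ltr01; have [f Af] := filter_ex FA.
  pose hL := GRing.isLinear.Build R X Y *:%R h hl.
  pose hh : {linear X -> Y} := HB.pack h hL.
  apply: (@bounded_linear_continuous _ _ _ hh); apply/linear_boundedP.
  near=> r => x; rewrite -[hh x]/(h x) -(subrK (f x) (h x)).
  rewrite (le_trans (ler_normD _ _))// distrC.
  rewrite (le_trans (lerD (A1 _ x Af) (op_normP f x)))// -mulrDl.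
  by rewrite ler_wpM2r//; near: r; apply: nbhs_pinfty_ge; rewrite num_real.
pose H : bop X Y := Bop (mem_set (conj hl hc)).
apply/cvg_ex; exists H; apply/cvgrPdist_le => e e0.
have [A FA Ae] := hA _ e0; near=> f; rewrite distrC.
apply: op_norm_le => x x1.
have Af : A f by near: f; exact: FA.
by rewrite (le_trans (Ae f x Af))// ler_piMr// ltW.
Unshelve. all: by end_near. Qed.

HB.instance Definition _ := Uniform_isComplete.Build (bop X Y) bop_complete.

End BoundedOperatorsComplete.

Definition dual (R : realType) (X : normedModType R) := bop X R^o.

HB.instance Definition _ (R : realType) (X : normedModType R) :=
  CompleteNormedModule.on (dual X).

Section WeakNotions.
Context {R : realType} (Z : normedModType R).

Definition weak : Type := sup_topology (fun f : dual Z =>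
  Topological.class (initial_topology (f : Z -> R))).

HB.instance Definition _ := Topological.on weak.

Definition relatively_weakly_compact (K : set Z) := precompact (K : set weak).

Definition weakly_null (u : nat -> Z) :=
  forall f : dual Z, f (u n) @[n --> \oo] --> (0 : R).

Definition weakly_p_summable (p : R) (u : nat -> Z) :=
  forall f : dual Z, cvgn (series (fun n => `|f (u n)| `^ p)).

Definition reflexive_space :=
  forall phi : dual (dual Z), exists z : Z, forall f : dual Z, phi f = f z.

End WeakNotions.

Section RightNotions.
Context {R : realType} (p : R) (Z : normedModType R).

Definition dunford_pettis (K : set Z) :=
  bounded_set K /\
  forall f : nat -> dual Z, weakly_null f ->
    {uniform K, (fun n => f n : Z -> R) @ \oo --> (fun=> 0 : R)}.

Definition p_Right_null (u : nat -> Z) :=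
  weakly_p_summable p u /\ dunford_pettis (range u).

Definition p_Right_set (K : set (dual Z)) :=
  bounded_set K /\
  forall u : nat -> Z, p_Right_null u ->
    sup [set `|f (u n)| | f in K] @[n --> \oo] --> (0 : R).

Definition p_SR :=
  forall K : set (dual Z), p_Right_set K -> relatively_weakly_compact K.

End RightNotions.

Definition compact_operator (R : realType) (X Y : normedModType R)
  (T : bop X Y) := precompact (T @` [set x | `|x| <= 1]).

(* An element of the algebraic tensor product of X and Y is written as a
   formal sum of elementary tensors x (x) y, i.e., as a list of pairs; scalars
   are absorbed in the first component. *)
Section ProjectiveTensorProduct.
Context {R : realType} (X Y : normedModType R).

Definition tensor_sum (V : lmodType R) (b : X -> Y -> V) (s : seq (X * Y)) : V :=
  \sum_(w <- s) b w.1 w.2.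

(* x (x) y is the functional B |-> B x y on the space of all (not necessarily
   bounded) bilinear forms, so two formal sums denote the same tensor iff no
   bilinear form distinguishes them. *)
Definition tensor_eq (s t : seq (X * Y)) :=
  forall B : {bilinear X -> Y -> R^o}, tensor_sum B s = tensor_sum B t.

Definition projective_norm (s : seq (X * Y)) : R :=
  inf [set \sum_(w <- t) `|w.1| * `|w.2| | t in tensor_eq s].

(* Z, with [tau x y] as the elementary tensor x (x) y, is a completion of the
   algebraic tensor product for the projective norm. *)
Definition projective_tensor_product (Z : completeNormedModType R)
    (tau : {bilinear X -> Y -> Z}) :=
  (forall s, `|tensor_sum tau s| = projective_norm s) /\
  dense (range (tensor_sum tau)).

End ProjectiveTensorProduct.

(* Main.v *)
Require Import Defs.
From HB Require Import structures.
From mathcomp Require Import all_boot all_order all_algebra.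
From mathcomp Require Import sesquilinear lra.
From mathcomp Require Import all_classical all_reals all_analysis.

(** Let K be a p-Right subset of the dual of Z, the projective tensor product
of X and Y, and let L be its weak closure, which is again p-Right.  The
elements of L are bounded bilinear forms T(x, y), and L is weakly compact as
soon as every ultrafilter U on L converges weakly.  The only candidate for the
limit is the pointwise limit S of U.

Two things are known about S.  For a fixed y the map T |-> T(., y) is the
adjoint of x |-> x (x) y, hence carries L to a p-Right set of the dual of X;
this set is relatively weakly compact because X has the p-(SR) property, so
T(., y) tends to S(., y) weakly along every ultrafilter on L, S being the
pointwise limit ([p_SR_adjoint_cvg]).  Next, if (x_k) and (y_k) lie in the
unit balls, (x_k) converges weakly* to xi in the bidual of X and (y_k)
converges weakly to y0 in Y, which by reflexivity happens along any
ultrafilter, then T(x_k, y_k) tends to xi(T(., y0)): the operator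
x |-> T(x, .) is compact, so y_k may be replaced by y0 at vanishing cost
([tensor_weak_cvg]).  Together these say that T(x, y) satisfies Grothendieck's
double limit condition on L times the unit tensors.

Suppose that some phi in the bidual of Z satisfies phi(T - S) >= theta > 0 on
a set of U.  No convex combination of such forms T - S is then small in norm,
and the norm is computed on unit tensors ([tensor_norming]), so no convex
combination of the functions |T - S| is uniformly small on unit tensors,
although these functions tend to 0 along U at each unit tensor.  A variant of
Ptak's combinatorial lemma ([ptak_double_sequence]) turns this into finite
sets B_i of forms and unit tensors (x_k, y_k) such that some T in B_i has
|T - S|(x_k, y_k) >= e when i <= k, while |T - S|(x_k, y_k) < 1/(i + 1) for
all T in B_i when k < i.  Take the limits xi and y0 along a free ultrafilter on
the indices.  As B_i is finite, a single T_i in B_i serves for almost all k,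
and then |xi(T_i(., y0)) - xi(S(., y0))| >= e, so the limit S' of (T_i)
satisfies |xi(S'(., y0)) - xi(S(., y0))| >= e; but S' = S at every
(x_k, y_k), so the same difference is 0.  This direct use of ultrafilters
replaces the Eberlein-Smulian theorem and the integral representation of
functionals on spaces of continuous functions. *)

Set Implicit Arguments.
Unset Strict Implicit.
Unset Printing Implicit Defensive.

Import Order.TTheory GRing.Theory Num.Theory.
Import numFieldNormedType.Exports.

Local Open Scope classical_set_scope.
Local Open Scope ring_scope.

(** * Limits along ultrafilters *)

Lemma ultra_fmap (I T : Type) (V : set_system I) (g : I -> T) :
  UltraFilter V -> UltraFilter (g @ V).
Proof.
move=> VU; split; first exact: fmap_proper_filter.
move=> G GF VG; apply/seteqP; split=> // A GA.
have [//|VA] := in_ultra_setVsetC (g @^-1` A) VU.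
have GnA : G (~` A) by apply: VG.
by have /filter_ex[x []] : G (A `&` ~` A) by exact: filterI.
Qed.

Lemma ultra_exists_seq (I : Type) (A : eqType) (V : set_system I) (B : seq A)
    (Q : A -> I -> Prop) :
  UltraFilter V -> V [set i | exists2 a, a \in B & Q a i] ->
  exists2 a, a \in B & V [set i | Q a i].
Proof.
move=> VU; elim: B => [|b B IH] VB.
  by have [i [a]] := filter_ex VB; rewrite in_nil.
have [Vb|Vnb] := in_ultra_setVsetC [set i | Q b i] VU.
  by exists b => //; exact: mem_head.
have [|a aB Va] := IH.
  apply: filterS (filterI VB Vnb) => i [[a + Qa] /= nQb].
  by rewrite inE => /orP[/eqP ab|aB]; [rewrite ab in Qa|exists a].
by exists a => //; rewrite inE aB orbT.
Qed.

Section UltrafilterLimits.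
Context {R : realType}.

Lemma ultra_cvg_bounded (I : Type) (V : set_system I) (g : I -> R) (M : R) :
  UltraFilter V -> V [set i | `|g i| <= M] -> exists l : R, g @ V --> l.
Proof.
move=> VU gM.
have := @segment_compact R (- M) M; rewrite compact_ultra.
move=> /(_ (g @ V) (ultra_fmap g VU))[].
- by apply: (@filterS _ V _ _ _ _ gM) => i; rewrite /= ler_norml in_itv.
- by move=> l [_ gl]; exists l.
Qed.

Lemma ultra_lim_unique (I : Type) (V : set_system I) (g : I -> R) (l l' : R) :
  ProperFilter V -> g @ V --> l -> g @ V --> l' -> l = l'.
Proof.
move=> VF gl gl'.
by rewrite -(cvg_lim (@norm_hausdorff _ R) gl) -(cvg_lim (@norm_hausdorff _ R) gl').
Qed.

Lemma ultra_ge (I : Type) (V : set_system I) (g : I -> R) (l a : R) :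
  ProperFilter V -> g @ V --> l -> V [set i | a <= g i] -> a <= l.
Proof.
move=> VF gl ag.
by apply: (@closed_cvg _ _ V _ g [set r | a <= r]) => //; exact: closed_ge.
Qed.

End UltrafilterLimits.

(** * Bounded operators, adjoints and the weak topology *)

Section Operators.
Context {R : realType}.

Lemma bop_of_bounded (X Y : normedModType R) (h : X -> Y) (M : R) :
  linear h -> (forall x, `|h x| <= M * `|x|) -> exists f : bop X Y, forall x, f x = h x.
Proof.
move=> hl hM.
pose hL := GRing.isLinear.Build R X Y *:%R h hl.
pose hh : {linear X -> Y} := HB.pack h hL.
have hc : continuous h.
  apply: (@bounded_linear_continuous _ _ _ hh); apply/linear_boundedP.
  near=> r => x; apply: le_trans (hM x) _.
  by rewrite ler_wpM2r//; near: r; apply: nbhs_pinfty_ge; rewrite num_real.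
by exists (Bop (mem_set (conj hl hc))).
Unshelve. all: by end_near. Qed.

(** This is the Banach-Alaoglu theorem in the form used below: the pointwise
    limit is linear, and inherits the bound M. *)
Lemma dual_ultra_lim (X : normedModType R) (I : Type) (V : set_system I)
    (T : I -> dual X) (M : R) :
  UltraFilter V -> V [set i | op_norm (T i) <= M] ->
  exists S : dual X, forall x, (fun i => T i x : R) @ V --> (S x : R).
Proof.
move=> VU TM.
have lim x : exists l : R, (fun i => T i x : R) @ V --> l.
  apply: (@ultra_cvg_bounded _ _ _ _ (M * `|x|)).
  by apply: filterS TM => i /= TiM; rewrite (le_trans (op_normP _ _))// ler_wpM2r.
have [S hS] := choice lim.
have Sl : linear (S : X -> R^o).
  move=> a u v.
  apply: (@ultra_lim_unique R I V (fun i => T i (a *: u + v)) (S (a *: u + v))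
    (a * S u + S v)) => //.
  have -> : (fun i => T i (a *: u + v) : R) = (fun i => a * T i u + T i v).
    by apply/funext => i; rewrite linearP.
  by apply: cvgD => //; apply: cvgMl_tmp.
have SM x : `|S x| <= M * `|x|.
  apply: (@closed_cvg _ _ V _ (fun i => `|T i x|) [set r : R | r <= M * `|x|]).
  - exact: closed_le.
  - by apply: filterS TM => i /= TiM; rewrite (le_trans (op_normP _ _))// ler_wpM2r.
  - exact: cvg_norm.
have [f fS] := bop_of_bounded Sl SM.
by exists f => x; rewrite fS.
Qed.

Lemma bidual_eval (X : normedModType R) (x : X) :
  exists J : dual (dual X), (forall f : dual X, J f = f x) /\ op_norm J <= `|x|.
Proof.
have el : linear (fun f : dual X => f x : R^o) by [].
have eM (f : dual X) : `|f x| <= `|x| * `|f| by rewrite mulrC; exact: op_normP.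
have [J Jx] := bop_of_bounded el eM.
exists J; split=> //; apply: op_norm_le => f f1; rewrite Jx.
by rewrite (le_trans (eM f))// ler_piMr.
Qed.

Lemma weak_cvgP (X : normedModType R) (F : set_system X) (x : X) :
  Filter F ->
  ((F : set_system (weak X)) --> (x : weak X)) <->
  forall f : dual X, (f : X -> R) @ F --> (f x : R).
Proof.
move=> FF; split.
  move=> /cvg_sup Fx f; have {Fx} Fx := Fx f.
  apply: (@cvg_comp _ _ _ id (f : X -> R) _ _ _ Fx).
  exact: (@initial_continuous X R (f : X -> R)).
move=> Fx; apply/cvg_sup => f A [_ [[B oB <-] Bfx] sBA].
by apply: filterS sBA _; apply: (Fx f); exact: open_nbhs_nbhs.
Qed.

Lemma adjointP (X Z : normedModType R) (A : bop X Z) :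
  exists A' : bop (dual Z) (dual X), forall f x, A' f x = f (A x).
Proof.
have comp (f : dual Z) : exists g : dual X, forall x, g x = f (A x).
  have fl : linear (fun x => f (A x) : R^o) by move=> a u v; rewrite !linearP.
  apply: (bop_of_bounded (M := op_norm f * op_norm A) fl) => x.
  rewrite (le_trans (op_normP _ _))// -mulrA ler_wpM2l ?op_norm_ge0//.
  exact: op_normP.
have [h hE] := choice comp.
have hl : linear h.
  move=> a f g; apply/val_inj/funext => x /=.
  by rewrite hE -[RHS]/(a *: h f x + h g x) !hE.
have hM f : `|h f| <= op_norm A * `|f|.
  apply: op_norm_le => x x1; rewrite hE mulrC (le_trans (op_normP _ _))//.
  by rewrite ler_wpM2l ?op_norm_ge0// op_norm_ball.
have [A' A'E] := bop_of_bounded hl hM.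
by exists A' => f x; rewrite A'E hE.
Qed.

End Operators.

(** * A variant of Ptak's combinatorial lemma *)

Section Ptak.
Context {R : realType} (A : eqType) (W : eqType).
Variables (U : set_system A) (f : A -> W -> R).

(** Finite families of elements of G with nonnegative weights; keeping the
    total weight n as a parameter makes averages of several convex combinations
    into concatenations. *)
Definition weighted (G : set A) (n : R) (s : seq (R * A)) :=
  (forall x, x \in s -> 0 <= x.1 /\ G x.2) /\ \sum_(x <- s) x.1 = n.

Definition mix (s : seq (R * A)) (w : W) := \sum_(x <- s) x.1 * f x.2 w.

(** The negation of: every set of U carries convex combinations of the
    functions f a that are at most a uniformly on P. *)
Definition not_small (P : set W) (a : R) :=
  exists2 G, U G & forall s, weighted G 1 s -> exists2 w, P w & a < mix s w.

Lemma weighted_cat G n m s t :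
  weighted G n s -> weighted G m t -> weighted G (n + m) (s ++ t).
Proof.
move=> [sG <-] [tG <-]; split; last by rewrite big_cat.
by move=> x; rewrite mem_cat => /orP[/sG|/tG].
Qed.

Lemma weighted_scale G n s (c : R) : 0 <= c ->
  weighted G n s -> weighted G (c * n) [seq (c * x.1, x.2) | x <- s].
Proof.
move=> c0 [sG <-]; split; last by rewrite big_map mulr_sumr.
by move=> _ /mapP[x /sG[x0 Gx] ->] /=; rewrite mulr_ge0.
Qed.

Lemma mix_scale (c : R) s w :
  mix [seq (c * x.1, x.2) | x <- s] w = c * mix s w.
Proof.
by rewrite /mix big_map mulr_sumr; apply: eq_bigr => x _ /=; rewrite mulrA.
Qed.

Lemma mix_le G n s w (c : R) : weighted G n s ->
  (forall x, x \in s -> f x.2 w <= c) -> mix s w <= n * c.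
Proof.
move=> [sG <-] fc; rewrite /mix mulr_suml big_seq [leRHS]big_seq.
apply: ler_sum => x xs; have [x0 _] := sG x xs.
by rewrite ler_wpM2l// fc.
Qed.

Definition hit (e : R) (B : seq A) (w : W) := exists2 a, a \in B & e <= f a w.

Context (UF : ProperFilter U).
Variables (P0 : set W) (G0 : set A) (C : R).
Hypothesis C0 : 0 <= C.
Hypothesis fC : forall a w, G0 a -> P0 w -> f a w <= C.
Hypothesis G0U : U G0.

(** Fix b strictly between e and a.  If the conclusion failed with a' = b, every
    finite B would leave a convex combination, supported in G, that is at most
    b on the points of P hit by B.  Choose s_1, s_2, ... successively, each one for the union B of the
    previous supports.  At a given point, the terms of s_1 + ... + s_n are at
    most e before the first support that hits it, at most C for that one, and
    at most b afterwards; the average is therefore at most b + C / n, which is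
    at most a for n large, and this contradicts [not_small P a].  The bound may
    drop from a to a', but it stays above e, so that the step can be iterated
    for ever with the same e. *)
Lemma not_small_refine (P : set W) (G : set A) (a e : R) :
  P `<=` P0 -> U G -> 0 <= e < a -> not_small P a ->
  exists B : seq A, (forall x, x \in B -> G x) /\
    exists2 a', e < a' & not_small (P `&` hit e B) a'.
Proof.
move=> PP0 UG /andP[e0 ea] [Gs UGs Pa]; apply: contrapT => noB.
pose b := (a + e) / 2.
have eb : e < b by rewrite /b; lra.
have ba : b < a by rewrite /b; lra.
have b0 : 0 <= b by lra.
pose H := G `&` (G0 `&` Gs).
have UH : U H by apply: filterI => //; exact: filterI.
have small B : (forall x, x \in B -> H x) ->
    exists2 s, weighted H 1 s & forall w, P w -> hit e B w -> mix s w <= b.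
  move=> BH; apply: contrapT => nos; apply: noB; exists B; split.
    by move=> x /BH[].
  exists b => //; exists H => // s sH; apply: contrapT => now.
  apply: nos; exists s => // w Pw hw; rewrite leNgt; apply/negP => bw.
  by apply: now; exists w.
(* s is the sum s_1 + ... + s_n *)
have build n : exists2 s, weighted H n%:R s &
    forall w, P w -> mix s w <= n%:R * b + C.
  elim: n => [|n [s sH sP]].
    exists [::]; first by split=> //; rewrite big_nil.
    by move=> w _; rewrite /mix big_nil mul0r add0r.
  have [|t tH tP] := small [seq x.2 | x <- s].
    by case: sH => sH _ _ /mapP[x /sH[_ Hx] ->].
  exists (t ++ s); first by rewrite -addn1 addnC natrD; exact: weighted_cat.
  move=> w Pw; rewrite /mix big_cat /= -!/(mix _ w).
  rewrite -addn1 natrD mulrDl mul1r.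
  have [hw|nhw] := pselect (hit e [seq x.2 | x <- s] w).
    by have := tP w Pw hw; have := sP w Pw; lra.
  have tC : mix t w <= 1 * C.
    apply: (mix_le tH) => x xt; apply: fC; last exact: PP0.
    by have [_ [_ []]] := tH.1 x xt.
  have sb : mix s w <= n%:R * b.
    apply: (mix_le sH) => x xs; rewrite leNgt; apply/negP => bx.
    by apply: nhw; exists x.2; rewrite ?map_f// ltW// (lt_trans eb).
  lra.
pose n := (Num.truncn (C / (a - b))).+1.
have [s sH sP] := build n.
have n0 : 0 < n%:R :> R by rewrite ltr0n.
have [|w Pw] := Pa [seq (n%:R^-1 * x.1, x.2) | x <- s].
  have := weighted_scale (c := n%:R^-1) _ sH.
  rewrite mulVf ?gt_eqF// invr_ge0 ltW// => /(_ isT)[sG s1]; split=> //.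
  by move=> x /sG[? [_ []]].
rewrite mix_scale ltNge => /negP; apply.
rewrite ler_pdivrMl// (le_trans (sP w Pw))//.
rewrite -lerBrDl -mulrBr -ler_pdivrMr ?subr_gt0//.
by apply/ltW; rewrite truncnS_gt// divr_ge0// subr_ge0 ltW.
Qed.

Lemma not_small_neq0 P a : not_small P a -> P !=set0.
Proof.
move=> [G /filter_ex[x Gx]] /(_ [:: (1, x)])[|w Pw _]; last by exists w.
split; last by rewrite big_seq1.
by move=> y; rewrite inE => /eqP ->.
Qed.

Hypothesis f0 : forall w, P0 w -> forall d, 0 < d -> U [set a | f a w < d].

(** Refine P0 successively by [not_small_refine]; the i-th step uses only
    elements a of G0 with f a below 1 / (i + 1) at the points already chosen,
    a set of U by [f0].  The point w_k is
    taken in the k-th refinement, so that it is hit by B_0, ..., B_k. *)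
Lemma ptak_double_sequence (a e : R) : 0 <= e < a -> not_small P0 a ->
  exists (B : nat -> seq A) (w : nat -> W),
  [/\ forall i x, x \in B i -> G0 x,
      forall k, P0 (w k),
      forall i k, (i <= k)%N -> hit e (B i) (w k)
    & forall i k x, (k < i)%N -> x \in B i -> f x (w k) < i.+1%:R^-1].
Proof.
move=> /andP[e0 ea] sa.
(* a state is the current refinement of P0, its bound, and the list of the
   points chosen so far, latest first *)
pose good (q : set W * R * seq W) :=
  [/\ q.1.1 `<=` P0, e < q.1.2, not_small q.1.1 q.1.2
    & forall w, w \in q.2 -> P0 w].
pose rel (q q' : {q | good q}) (Bw : seq A * W) :=
  [/\ forall x, x \in Bw.1 -> G0 x,
      (sval q').1.1 `<=` (sval q).1.1 `&` hit e Bw.1,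
      (sval q').1.1 Bw.2,
      (sval q').2 = Bw.2 :: (sval q).2
    & forall x w, x \in Bw.1 -> w \in (sval q).2 ->
        f x w < (size (sval q).2).+1%:R^-1].
have Uh d (h : seq W) : 0 < d -> (forall w, w \in h -> P0 w) ->
    U [set x | forall w, w \in h -> f x w < d].
  move=> d0; elim: h => [|w h IH] hP0.
    by apply: (@filterS _ U _ setT) => //; exact: filterT.
  have Uw : U [set x | f x w < d] by apply: f0 => //; apply: hP0; exact: mem_head.
  have Uh : U [set x | forall w, w \in h -> f x w < d].
    by apply: IH => v vh; apply: hP0; rewrite inE vh orbT.
  apply: filterS (filterI Uw Uh) => x [/= xw xh] v.
  by rewrite inE => /orP[/eqP ->|/xh].
have step q : exists q', exists Bw, rel q q' Bw.
  case: q => -[[P b] h] [/= PP0 eb sb hP0].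
  pose d : R := (size h).+1%:R^-1.
  have d0 : 0 < d by rewrite invr_gt0 ltr0n.
  have UG : U (G0 `&` [set x | forall w, w \in h -> f x w < d]).
    by apply: filterI => //; exact: Uh.
  have [|B [BG [b' eb' sb']]] := not_small_refine (e := e) PP0 UG _ sb.
    by rewrite e0.
  have [w [Pw hw]] := not_small_neq0 sb'.
  have good' : good (P `&` hit e B, b', w :: h).
    split=> //=; first by move=> v [/PP0].
    by move=> v; rewrite inE => /orP[/eqP ->|/hP0]; [exact: PP0|].
  exists (exist _ _ good'), (B, w); split=> //=.
  - by move=> x /BG[].
  - by move=> x v /BG[_ +] vh; exact.
have good0 : good (P0, a, [::]) by split.
have [F FP] := choice step.
pose Q n := iter n F (exist _ _ good0).
have [Bw BwP] : exists Bw, forall n, rel (Q n) (Q n.+1) (Bw n).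
  by have [Bw BwP] := choice FP; exists (Bw \o Q) => n; exact: BwP.
pose w k := (Bw k).2.
have hE n : (sval (Q n)).2 = rev (mkseq w n).
  elim: n => [|n IH]; first by [].
  have [_ _ _ -> _] := BwP n.
  by rewrite IH /mkseq -addn1 iotaD map_cat rev_cat.
have Pdec i k : (i <= k)%N -> (sval (Q k)).1.1 `<=` (sval (Q i)).1.1.
  move=> /subnK <-; elim: (k - i)%N => // n IH.
  by have [_ + _ _ _] := BwP (n + i)%N => /subset_trans; apply => v [/IH].
exists (fun i => (Bw i).1), w; split.
- by move=> i; have [] := BwP i.
- move=> k; have [_ _ + _ _] := BwP k.
  by have [+ _ _ _] := proj2_sig (Q k.+1); exact.
- move=> i k ik; have [_ + _ _ _] := BwP i; have [_ _ + _ _] := BwP k.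
  by move=> /(@Pdec i.+1 k.+1 ik) /[swap] /[apply] -[].
- move=> i k x ki xB; have [_ _ _ _ /(_ x (w k) xB)] := BwP i.
  rewrite hE size_rev size_mkseq; apply.
  by rewrite mem_rev; apply/mapP; exists k; rewrite // mem_iota.
Qed.

End Ptak.

(** * p-Right sets *)

Section Right.
Context {R : realType} (p : R).

Lemma bounded_setP (X : normedModType R) (K : set X) :
  bounded_set K <-> exists M, forall x, K x -> `|x| <= M.
Proof.
split=> [Kb|[M KM]]; last first.
  rewrite /= /bounded_near; near=> r => x Kx /=.
  by rewrite (le_trans (KM x Kx))//; near: r;
     apply: nbhs_pinfty_ge; rewrite num_real.
by near +oo_R => r; exists r; near: r; exact: Kb.
Unshelve. all: by end_near. Qed.

(** The Dunford-Pettis half holds because A' maps weakly null sequences of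
    functionals to weakly null sequences, thanks to its own adjoint. *)
Lemma p_Right_null_image (X Z : normedModType R) (A : bop X Z) (u : nat -> X) :
  p_Right_null p u -> p_Right_null p (A \o u).
Proof.
move=> [us [ub uDP]]; have [A' A'E] := adjointP A; split.
  move=> f; have := us (A' f).
  by congr (cvgn (series _)); apply/funext => n /=; rewrite A'E.
split.
  apply/bounded_setP; have /bounded_setP[M uM] := ub.
  exists (op_norm A * M) => _ [n _ <-] /=.
  rewrite (le_trans (op_normP _ _))// ler_wpM2l ?op_norm_ge0//.
  by apply: uM; exists n.
move=> f f0 P /uniform_nbhs[E [entE EP]].
have A'f0 : weakly_null (fun n => A' (f n)).
  move=> phi; have [A'' A''E] := adjointP A'.
  by have := f0 (A'' phi); under eq_fun do rewrite A''E.
pose Q : set (X -> R) := [set h | forall y, range u y -> E (0, h y)].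
have /(uDP _ A'f0) : nbhs ((fun=> 0 : R) : {uniform` range u -> R}) Q.
  by apply/uniform_nbhs; exists E; split.
move=> uQ; suff : \forall n \near \oo, P (f n) by [].
have : \forall n \near \oo, Q (A' (f n)) by [].
apply: filterS => n fn; apply: EP => _ [k _ <-] /=.
by rewrite -A'E; apply: fn; exists k.
Qed.

Lemma p_Right_set_adjoint (X Z : normedModType R) (A : bop X Z)
    (A' : bop (dual Z) (dual X)) (K : set (dual Z)) :
  (forall f x, A' f x = f (A x)) -> p_Right_set p K ->
  p_Right_set p (A' @` K).
Proof.
move=> A'E [Kb Kp]; split.
  apply/bounded_setP; have /bounded_setP[M KM] := Kb.
  exists (op_norm A' * M) => _ [f Kf <-].
  by rewrite (le_trans (op_normP _ _))// ler_wpM2l ?op_norm_ge0// KM.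
move=> u uR; have := Kp _ (p_Right_null_image A uR).
suff -> : (fun n => sup [set `|f (u n)| | f in A' @` K]) =
    (fun n => sup [set `|f ((A \o u) n)| | f in K]) by [].
apply/funext => n; rewrite image_comp.
by congr (sup (_ @` K)); apply/funext => f /=; rewrite A'E.
Qed.

Lemma weak_closure_ub (X : normedModType R) (K : set X) (f : dual X) (c : R) :
  (forall x, K x -> `|f x| <= c) ->
  forall x, closure (K : set (weak X)) x -> `|f x| <= c.
Proof.
move=> Kc x; rewrite closureEcvg => -[F FF [Fx KF]].
have /weak_cvgP/(_ f) := Fx.
move=> fx.
apply: (@closed_cvg _ _ F _ (fun i => `|f i|) [set r : R | r <= c]).
- exact: closed_le.
- by apply: KF => y; exact: Kc.
- exact: (cvg_norm fx).
Qed.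

(** For each z the inequality |f z| <= c passes to the weak closure, since
    evaluation at z belongs to the bidual; the suprema defining p-Right sets
    are thus those of K. *)
Lemma p_Right_set_weak_closure (Z : normedModType R) (K : set (dual Z)) :
  p_Right_set p K -> p_Right_set p (closure (K : set (weak (dual Z)))).
Proof.
move=> [/bounded_setP[M KM] Kp].
have ub z c : (forall f, K f -> `|f z| <= c) ->
    forall f : dual Z, closure (K : set (weak (dual Z))) f -> `|f z| <= c.
  move=> Kc f Kf; have [J [JE _]] := bidual_eval z; rewrite -JE.
  by apply: (weak_closure_ub _ Kf) => g Kg; rewrite JE; exact: Kc.
have [->|/set0P[f0 Kf0]] := eqVneq K set0.
  split; first by apply/bounded_setP; exists 0 => x; rewrite closure0.
  move=> u _; rewrite closure0 (_ : (fun _ => _) = cst 0); first exact: cvg_cst.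
  by apply/funext => n; rewrite image_set0 sup0.
have M0 : 0 <= M by exact: le_trans (KM _ Kf0).
split.
  apply/bounded_setP; exists M => f Kf; apply: op_norm_le => z z1.
  apply: (ub z) Kf => g Kg; rewrite (le_trans (op_norm_ball _ z1))//.
  exact: KM.
move=> u /Kp; apply: squeeze_cvgr (cvg_cst 0).
have bnd n f : K f -> `|f (u n)| <= M * `|u n|.
  by move=> Kf; rewrite (le_trans (op_normP _ _))// ler_wpM2r// KM.
have fle n f : closure (K : set (weak (dual Z))) f ->
    `|f (u n)| <= sup [set `|g (u n)| | g in K].
  move=> Kf; apply: (ub _ _ _ _ Kf) => g Kg.
  apply: sup_upper_bound; last by exists g.
  split; first by exists `|g (u n)|, g.
  by exists (M * `|u n|) => _ [h Kh <-]; exact: bnd.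
have cf0 : closure (K : set (weak (dual Z))) f0 by exact: subset_closure.
apply: nearW => n; apply/andP; split.
  apply: le_trans (normr_ge0 (f0 (u n))) _; apply: sup_upper_bound.
    split; first by exists `|f0 (u n)|, f0.
    exists (sup [set `|g (u n)| | g in K]) => _ [h Kh <-]; exact: fle.
  by exists f0.
apply: ge_sup; first by exists `|f0 (u n)|, f0.
by move=> _ [f Kf <-]; exact: fle.
Qed.

End Right.

Section Limits.
Context {R : realType}.

(** The adjoint A' maps L into a relatively weakly compact set, so A' (T i) has
    a weak limit along V; evaluating at points of X shows that it is A' S. *)
Lemma p_SR_adjoint_cvg (p : R) (X Z : normedModType R) (A : bop X Z)
    (A' : bop (dual Z) (dual X)) (L : set (dual Z)) (I : Type)
    (V : set_system I) (T : I -> dual Z) (S : dual Z) :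
  p_SR p X -> (forall f x, A' f x = f (A x)) -> p_Right_set p L ->
  UltraFilter V -> V [set i | L (T i)] ->
  (forall z, (fun i => T i z : R) @ V --> (S z : R)) ->
  forall phi : dual (dual X), (fun i => phi (A' (T i)) : R) @ V --> (phi (A' S) : R).
Proof.
move=> hX A'E LR VU VL TS.
have := hX _ (p_Right_set_adjoint A'E LR).
rewrite /relatively_weakly_compact precompactE compact_ultra.
move=> /(_ ((A' \o T) @ V) (ultra_fmap _ VU))[].
  apply: (@filterS _ V _ _ _ _ VL) => i Li /=.
  by apply: subset_closure; exists (T i).
move=> h [_ /weak_cvgP hE].
have hS : h = A' S.
  apply/val_inj/funext => x /=.
  have [J [JE _]] := bidual_eval x.
  have hx : (fun i => J (A' (T i)) : R) @ V --> (J h : R) := hE J.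
  have Sx : (fun i => J (A' (T i)) : R) @ V --> (J (A' S) : R).
    by rewrite JE A'E; under eq_fun do rewrite JE A'E; exact: TS.
  have e : J h = J (A' S) :> R := ultra_lim_unique _ hx Sx.
  by rewrite -[LHS]/(h x) -[RHS]/(A' S x) -!JE; exact: e.
by move=> phi; rewrite -hS; exact: hE.
Qed.

(** By compactness T (x i) converges in norm to some g, so the difference is
    close to g (y i) - g y0. *)
Lemma compact_operator_weak_cvg (X Y : normedModType R) (T : bop X (dual Y))
    (I : Type) (V : set_system I) (x : I -> X) (y : I -> Y) (y0 : Y) (M : R) :
  compact_operator T -> UltraFilter V -> (forall i, `|x i| <= 1) ->
  (forall i, `|y i| <= M) ->
  (forall h : dual Y, (fun i => h (y i) : R) @ V --> (h y0 : R)) ->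
  (fun i => T (x i) (y i) - T (x i) y0 : R) @ V --> (0 : R).
Proof.
move=> cT VU x1 yM yy0; move: cT.
rewrite /compact_operator precompactE compact_ultra.
move=> /(_ ((T \o x) @ V) (ultra_fmap _ VU))[].
  by apply: (@filterE _ V _) => i /=; apply: subset_closure; exists (x i) => //=.
move=> g [_ Tg].
apply/cvgrPdist_le => eps eps0.
have M0 : 0 <= M.
  have [i _] : exists i : I, True.
    by have [i _] := filter_ex (F := V) filterT; exists i.
  exact: le_trans (yM i).
have N0 : 0 < M + `|y0| + 1 by rewrite ltr_wpDl// addr_ge0.
have e1 : 0 < eps / 2 / (M + `|y0| + 1) by rewrite !divr_gt0.
have e2 : 0 < eps / 2 by rewrite divr_gt0.
have V1 : \forall i \near V, `|g - T (x i)| <= eps / 2 / (M + `|y0| + 1).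
  by have /cvgrPdist_le/(_ _ e1) : (T \o x) @ V --> g := Tg.
have V2 : \forall i \near V, `|g y0 - g (y i) : R| <= eps / 2.
  by have /cvgrPdist_le/(_ _ e2) := yy0 g.
apply: filterS (filterI V1 V2) => i [h1 h2].
have -> : 0 - (T (x i) (y i) - T (x i) y0) =
    (g - T (x i)) (y i - y0) + (g y0 - g (y i)) :> R.
  rewrite -[(g - T (x i)) (y i - y0)]/(g (y i - y0) - T (x i) (y i - y0)).
  by rewrite !linearB /=; lra.
rewrite (le_trans (ler_normD _ _))// [leRHS]splitr lerD//.
rewrite (le_trans (op_normP _ _))//.
apply: (@le_trans _ _ (eps / 2 / (M + `|y0| + 1) * (M + `|y0| + 1))).
  apply: ler_pM => //; first exact: op_norm_ge0.
  by rewrite (le_trans (ler_normB _ _))// -addrA lerD// lerDl.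
by rewrite divfK// gt_eqF.
Qed.

End Limits.

(** * Functionals on the projective tensor product *)

Section Tensor.
Context {R : realType} (X Y : normedModType R) (Z : completeNormedModType R).
Variable (tau : {bilinear X -> Y -> Z}).
Hypothesis hZ : projective_tensor_product tau.

Lemma norm_tensor_le x y : `|tau x y| <= `|x| * `|y|.
Proof.
have := hZ.1 [:: (x, y)]; rewrite /tensor_sum big_seq1 /= => ->.
apply: ge_inf.
  by exists 0 => _ [t _ <-]; apply: sumr_ge0 => w _; exact: mulr_ge0.
by exists [:: (x, y)]; rewrite ?big_seq1.
Qed.

(** A bound c on unit tensors gives c * |x| * |y| on all elementary tensors,
    hence c times the cost of any formal sum.  Since g (tau x y) is a bilinear
    form, the value of g is the same on all formal sums of a tensor, so the
    infimum over them can be taken; density concludes. *)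
Lemma tensor_norming (g : dual Z) (c : R) : 0 <= c ->
  (forall x y, `|x| <= 1 -> `|y| <= 1 -> `|g (tau x y)| <= c) -> op_norm g <= c.
Proof.
move=> c0 gc.
have gcxy x y : `|g (tau x y)| <= c * (`|x| * `|y|).
  have [->|x0] := eqVneq x 0; first by rewrite linear0l linear0 !normr0 mul0r mulr0.
  have [->|y0] := eqVneq y 0; first by rewrite linear0r linear0 !normr0 !mulr0.
  have := gc (`|x|^-1 *: x) (`|y|^-1 *: y).
  rewrite !normfZV// !lexx => /(_ isT isT).
  rewrite linearZl_LR linearZr_LR/= !linearZ/= !normrZ !normfV !normr_id.
  rewrite mulrA -invfM mulrC ler_pdivrMr// ?mulr_gt0 ?normr_gt0//.
have gbil : bilinear_for *:%R *:%R (fun x y => g (tau x y) : R^o).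
  split=> [y a u v|x a u v] /=.
    by rewrite linearPl linearP.
  by rewrite linearPr linearP.
pose Bi := bilinear_isBilinear.Build R X Y R^o *:%R *:%R _ gbil.
pose B : {bilinear X -> Y -> R^o} := HB.pack (fun x y => g (tau x y) : R^o) Bi.
have gsum s : g (tensor_sum tau s) = tensor_sum B s.
  by rewrite /tensor_sum linear_sum.
have gt s : `|g (tensor_sum tau s)| <= c * \sum_(w <- s) `|w.1| * `|w.2|.
  rewrite gsum mulr_sumr (le_trans (ler_norm_sum _ _ _))//.
  by apply: ler_sum => w _; exact: gcxy.
have gs s : `|g (tensor_sum tau s)| <= c * `|tensor_sum tau s|.
  have [c00|cn0] := eqVneq c 0; first by have := gt s; rewrite c00 !mul0r.
  have cp : 0 < c by rewrite lt_neqAle eq_sym cn0.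
  rewrite (hZ.1 s) -ler_pdivrMl//; apply: lb_le_inf.
    by exists (\sum_(w <- s) `|w.1| * `|w.2|), s.
  by move=> _ [t st <-]; rewrite ler_pdivrMl// gsum st -gsum.
apply: op_norm_le => z z1.
apply: (@le_trans _ _ (c * `|z|)); last by rewrite ler_piMr.
rewrite leNgt; apply/negP => cz.
pose O : set Z := (fun z => `|g z| - c * `|z| : R) @^-1` [set r | 0 < r].
have oO : open O.
  apply: open_comp; last exact: open_gt.
  move=> v _; apply: cvgB; first by apply: cvg_norm; exact: bop_continuous.
  by apply: cvgMl_tmp; apply: cvg_norm.
have Oz : O z by rewrite /O /= subr_gt0.
have [v [+ [s _ sv]]] := hZ.2 O (ex_intro _ z Oz) oO.
by rewrite -sv /O /= subr_gt0 ltNge gs.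
Qed.

Lemma tensor_slicel y : exists A : bop X Z, forall x, A x = tau x y.
Proof.
have l : linear (fun x => tau x y) by move=> a u v; rewrite linearPl.
by apply: (bop_of_bounded (M := `|y|) l) => x; rewrite mulrC norm_tensor_le.
Qed.

Lemma tensor_currying (T : dual Z) :
  exists B : bop X (dual Y), forall x y, B x y = T (tau x y).
Proof.
have TM x y : `|T (tau x y)| <= op_norm T * `|x| * `|y|.
  rewrite (le_trans (op_normP _ _))// -mulrA ler_wpM2l ?op_norm_ge0//.
  exact: norm_tensor_le.
have slice x : exists h : dual Y, forall y, h y = T (tau x y).
  have l : linear (fun y => T (tau x y) : R^o).
    by move=> a u v; rewrite linearPr linearP.
  exact: (bop_of_bounded l (TM x)).
have [h hE] := choice slice.
have hl : linear h.
  move=> a u v; apply/val_inj/funext => y /=.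
  by rewrite -[RHS]/(a *: h u y + h v y) !hE linearPl linearP.
have hM x : `|h x| <= op_norm T * `|x|.
  apply: op_norm_le => y y1; rewrite hE (le_trans (TM _ _))//.
  by rewrite ler_piMr// mulr_ge0// op_norm_ge0.
have [B BE] := bop_of_bounded hl hM.
by exists B => x y; rewrite BE hE.
Qed.

(** In T (tau (x i) (y i)) the compactness of u |-> T (tau u .) allows y i to be
    replaced by y0, and x i tends to xi against A' T = T (tau . y0). *)
Lemma tensor_weak_cvg (T : dual Z) (I : Type) (V : set_system I) (x : I -> X)
    (y : I -> Y) (y0 : Y) (A : bop X Z) (A' : bop (dual Z) (dual X))
    (xi : dual (dual X)) :
  (forall T : bop X (dual Y), compact_operator T) ->
  UltraFilter V -> (forall i, `|x i| <= 1) -> (forall i, `|y i| <= 1) ->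
  (forall u, A u = tau u y0) -> (forall f u, A' f u = f (A u)) ->
  (forall h : dual Y, (fun i => h (y i) : R) @ V --> (h y0 : R)) ->
  (forall h : dual X, (fun i => h (x i) : R) @ V --> (xi h : R)) ->
  (fun i => T (tau (x i) (y i)) : R) @ V --> (xi (A' T) : R).
Proof.
move=> hK VU x1 y1 AE A'E yy0 xxi.
have [B BE] := tensor_currying T.
have c1 : (fun i => B (x i) (y i) - B (x i) y0 : R) @ V --> (0 : R).
  exact: (compact_operator_weak_cvg (M := 1)).
have e : (fun i => T (tau (x i) (y i)) : R) =
    (fun i => (B (x i) (y i) - B (x i) y0) + A' T (x i) : R).
  by apply/funext => i; rewrite !BE A'E AE subrK.
rewrite e -[xi _]add0r; apply: cvgD c1 _; exact: xxi.
Qed.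

End Tensor.

(** * Weak limits of ultrafilters on p-Right sets *)

Section DoubleLimit.
Context {R : realType} (p : R) (X Y : normedModType R).
Context (Z : completeNormedModType R).
Hypothesis hX : p_SR p X.
Hypothesis hY : reflexive_space Y.
Hypothesis hK : forall T : bop X (dual Y), compact_operator T.
Variable (tau : {bilinear X -> Y -> Z}).
Hypothesis hZ : projective_tensor_product tau.

(** A convex combination h of the T - S has phi h >= theta, so its norm exceeds
    a constant depending on theta and phi only, and unit tensors norm h. *)
Lemma not_small_separated (U : set_system (dual Z)) (G : set (dual Z))
    (S : dual Z) (phi : dual (dual Z)) (theta : R) :
  0 < theta -> U G -> (forall T, G T -> theta <= phi (T - S)) ->
  exists2 c, 0 < c & not_small U (fun (T : dual Z) (w : X * Y) =>
      `|T (tau w.1 w.2) - S (tau w.1 w.2)|)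
    [set w | `|w.1| <= 1 /\ `|w.2| <= 1] c.
Proof.
move=> theta0 UG Gphi; pose N := op_norm phi + 1.
have N0 : 0 < N by rewrite ltr_wpDl// op_norm_ge0.
exists (theta / 2 / N); first by rewrite !divr_gt0.
exists G => // s [sG s1]; apply: contrapT => now.
pose h : dual Z := \sum_(x <- s) x.1 *: (x.2 - S).
have hE z : h z = \sum_(x <- s) x.1 * (x.2 z - S z) :> R.
  rewrite /h; elim: (s) => [|x r IH]; first by rewrite !big_nil.
  by rewrite !big_cons -IH.
have phih : theta <= phi h.
  rewrite /h linear_sum /= -[theta]mul1r -s1 mulr_suml big_seq [leRHS]big_seq.
  apply: ler_sum => x xs; rewrite linearZ /=; have [x0 Gx] := sG x xs.
  by rewrite ler_wpM2l// Gphi.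
have hn : op_norm h <= theta / 2 / N.
  apply: (tensor_norming hZ); first by rewrite ltW// !divr_gt0.
  move=> x y x1 y1; rewrite leNgt; apply/negP => hxy.
  apply: now; exists (x, y) => //=; apply: lt_le_trans hxy _.
  rewrite hE /mix (le_trans (ler_norm_sum _ _ _))// big_seq [leRHS]big_seq.
  apply: ler_sum => q qs; have [q0 _] := sG q qs.
  by rewrite normrM ger0_norm.
have : theta <= theta / 2.
  apply: (le_trans phih); apply: le_trans (ler_norm _) _.
  apply: le_trans (op_normP _ _) _.
  apply: (@le_trans _ _ (N * (theta / 2 / N))).
    by apply: ler_pM => //; [exact: op_norm_ge0|rewrite lerDl].
  by rewrite mulrC divfK// gt_eqF.
by apply/negP; rewrite -ltNge; lra.
Qed.

(** If phi separated S from a set of U, the double sequence given by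
    [ptak_double_sequence] would violate the double limit condition that
    [p_SR_adjoint_cvg] and [tensor_weak_cvg] give. *)
Lemma not_ultra_separated (L : set (dual Z)) (U : set_system (dual Z)) (S : dual Z)
    (phi : dual (dual Z)) (theta : R) :
  p_Right_set p L -> UltraFilter U -> U L ->
  (forall z, (fun T : dual Z => T z : R) @ U --> (S z : R)) ->
  0 < theta -> ~ U [set T | theta <= phi (T - S)].
Proof.
move=> LR UU UL TS theta0 Utheta.
have [/bounded_setP[M LM] _] := LR.
pose f (T : dual Z) (w : X * Y) : R := `|T (tau w.1 w.2) - S (tau w.1 w.2)|.
pose P0 : set (X * Y) := [set w | `|w.1| <= 1 /\ `|w.2| <= 1].
have [c c0 nsP0] : exists2 c, 0 < c & not_small U f P0 c.
  exact: (@not_small_separated _ _ S phi _ theta0 Utheta (fun T h => h)).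
pose C := `|M| + op_norm S.
have [||||B [w [BL wP Bhit Bsmall]]] :=
    @ptak_double_sequence R _ _ U f _ P0 L C _ _ UL _ c (c / 2) _ nsP0.
- by rewrite addr_ge0// op_norm_ge0.
- move=> T [x y] LT [/= x1 y1].
  have n1 : `|tau x y| <= 1.
    by rewrite (le_trans (norm_tensor_le hZ _ _))// mulr_ile1.
  rewrite /f (le_trans (ler_normB _ _))// lerD// ?op_norm_ball//.
  by rewrite (le_trans (op_norm_ball _ n1))// (le_trans (LM T LT))// ler_norm.
- move=> v _ d d0; have /cvgrPdist_lt/(_ _ d0) := TS (tau v.1 v.2).
  by apply: filterS => T; rewrite distrC.
- by apply/andP; split; lra.
pose xs k := (w k).1; pose ys k := (w k).2.
have xs1 k : `|xs k| <= 1 by have [] := wP k.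
have ys1 k : `|ys k| <= 1 by have [] := wP k.
(* V is a free ultrafilter on the indices *)
have [V [VU Voo]] := ultraFilterLemma (F := \oo) _.
have [Jx JxE] := choice (fun k => bidual_eval (xs k)).
have [Jy JyE] := choice (fun k => bidual_eval (ys k)).
have [xi xiE] : exists xi : dual (dual X), forall h : dual X,
    (fun k => h (xs k) : R) @ V --> (xi h : R).
  have [|xi xiE] := @dual_ultra_lim R _ _ V Jx 1 VU.
    by apply: filterE => k /=; rewrite (le_trans (JxE k).2).
  exists xi => h; have := xiE h.
  by under eq_fun do rewrite (JxE _).1.
have [y0 y0E] : exists y0 : Y, forall h : dual Y,
    (fun k => h (ys k) : R) @ V --> (h y0 : R).
  have [|eta etaE] := @dual_ultra_lim R _ _ V Jy 1 VU.
    by apply: filterE => k /=; rewrite (le_trans (JyE k).2).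
  have [y0 y0E] := hY eta; exists y0 => h; have := etaE h.
  by rewrite y0E; under eq_fun do rewrite (JyE _).1.
have [A AE] := tensor_slicel hZ y0; have [A' A'E] := adjointP A.
have limT (T : dual Z) :
    (fun k => T (tau (xs k) (ys k)) : R) @ V --> (xi (A' T) : R).
  exact: (tensor_weak_cvg hZ).
(* B i is finite and hits w k for all k >= i, so one element of B i does so
   along V *)
have T_ex i : exists T : dual Z, T \in B i /\ c / 2 <= `|xi (A' T) - xi (A' S)|.
  have [|T TB TV] := @ultra_exists_seq _ _ V (B i)
      (fun T k => c / 2 <= f T (w k)) VU.
    by apply: Voo; exists i => // k /= ik; exact: Bhit.
  exists T; split=> //; refine (ultra_ge _ _ TV).
  by apply: cvg_norm; apply: cvgB; exact: limT.
have [T_ T_P] := choice T_ex.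
have T_L i : L (T_ i) by apply: (BL i); exact: (T_P i).1.
have [|S' S'E] := @dual_ultra_lim R _ _ V T_ M VU.
  by apply: filterE => i /=; exact: LM.
have T_S' : (fun i => xi (A' (T_ i)) : R) @ V --> (xi (A' S') : R).
  by apply: (p_SR_adjoint_cvg hX A'E LR) => //; exact: filterE.
have gap : c / 2 <= `|xi (A' S') - xi (A' S)|.
  apply: (@ultra_ge _ _ V (fun i => `|xi (A' (T_ i)) - xi (A' S)|)).
    by apply: cvg_norm; apply: cvgB => //; exact: cvg_cst.
  by apply: filterE => i; exact: (T_P i).2.
have S'S k : S' (tau (xs k) (ys k)) = S (tau (xs k) (ys k)) :> R.
  apply: ultra_lim_unique (S'E _) _.
  apply/cvgrPdist_le => eps eps0; apply: Voo.
  near=> i; rewrite distrC.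
  apply/ltW; apply: (@lt_trans _ _ i.+1%:R^-1).
    apply: Bsmall; last exact: (T_P i).1.
    by near: i; exact: nbhs_infty_gt.
  by near: i; exact: (near_infty_natSinv_lt (PosNum eps0)).
have S'Sxi : xi (A' S') = xi (A' S) :> R.
  have := limT S'; under eq_fun do rewrite S'S.
  by move=> h; apply: ultra_lim_unique h (limT S).
by move: gap; rewrite S'Sxi subrr normr0; lra.
Unshelve. all: by end_near. Qed.

End DoubleLimit.

(** * The theorem *)

Theorem theorem3p15 (R : realType) (p : R) (hp : 1 <= p)
  (X Y : completeNormedModType R)
  (hX : p_SR p X) (hY : reflexive_space Y)
  (hK : forall T : bop X (dual Y), compact_operator T)
  (Z : completeNormedModType R) (tau : {bilinear X -> Y -> Z})
  (hZ : projective_tensor_product tau) :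
  p_SR p Z.
Proof.
move=> K /p_Right_set_weak_closure.
set L := closure _ => LR.
rewrite /relatively_weakly_compact precompactE compact_ultra => F FU FL.
have [/bounded_setP[M LM] _] := LR.
have [|S TS] := @dual_ultra_lim R Z (dual Z) F id M FU.
  by apply: (@filterS _ F _ _ _ _ FL) => T; exact: LM.
have FS : (F : set_system (weak (dual Z))) --> (S : weak (dual Z)).
  apply/weak_cvgP => phi; apply/cvgrPdist_lt => theta theta0.
  have [//|Fn] := in_ultra_setVsetC [set T | `|phi S - phi T| < theta] FU.
  have [Fp|Fm] := in_ultra_setVsetC [set T : dual Z | theta <= phi (T - S)] FU.
    by have := not_ultra_separated hX hY hK hZ LR FU FL TS theta0 Fp.
  (* the other sign is the same statement for - phi *)
  suff : F [set T : dual Z | theta <= (- phi) (T - S)].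
    by move/(not_ultra_separated hX hY hK hZ LR FU FL TS theta0).
  have pE T : phi (T - S) = phi T - phi S :> R by rewrite linearB.
  have nE T : (- phi) (T - S) = - phi (T - S) :> R by [].
  apply: filterS (filterI Fn Fm) => T [/negP + /negP]; rewrite /mkset -leNgt -ltNge.
  by rewrite nE pE; case: ler0P; lra.
exists S; split=> //.
have cL : closed L by exact: closed_closure.
by apply: cL => B /FS FB; exact: filter_ex (filterI FL FB).
Qed.
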